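(* For any formulae $A$ and $C$ and any derivation $f : A \Rightarrow C$ in the skew monoidal categorical calculus, there is a derivation of the sequent $A \mid\ \vdash C$ (stoup $A$, empty context) in the skew monoidal sequent calculus.
   Context: Fix a set $\mathrm{Var}$ of atoms. Formulae are generated by: every atom $X \in \mathrm{Var}$ is a formula; $\mathsf{I}$ is a formula; if $A, B$ are formulae then so is $A \otimes B$. A context $\Gamma$ is a finite list of formulae; a stoup $S$ is either empty (written $-$) or a single formula. The skew monoidal categorical calculus derives judgements $A \Rightarrow C$ ($A, C$ formulae) by the rules: $\mathrm{id}_A : A \Rightarrow A$; from $f : A \Rightarrow B$ and $g : B \Rightarrow C$ infer $g \circ f : A \Rightarrow C$; from $f : A \Rightarrow C$ and $g : B \Rightarrow D$ infer $f \otimes g : A \otimes B \Rightarrow C \otimes D$; and the axioms $\lambda_A : \mathsf{I} \otimes A \Rightarrow A$, $\rho_A : A \Rightarrow A \otimes \mathsf{I}$, $\alpha_{A,B,C} : (A \otimes B) \otimes C \Rightarrow A \otimes (B \otimes C)$. The skew monoidal sequent calculus derives sequents $S \mid \Gamma \vdash C$ (stoup $S$, context $\Gamma$, formula $C$) by the rules: (ax) $A \mid\ \vdash A$; (pass) from $A \mid \Gamma \vdash C$ infer $- \mid A, \Gamma \vdash C$; (scut) from $S \mid \Gamma \vdash A$ and $A \mid \Delta \vdash C$ infer $S \mid \Gamma, \Delta \vdash C$; (ccut) from $- \mid \Gamma \vdash A$ and $S \mid \Delta_0, A, \Delta_1 \vdash C$ infer $S \mid \Delta_0, \Gamma, \Delta_1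 \vdash C$; ($\mathsf{I}$L) from $- \mid \Gamma \vdash C$ infer $\mathsf{I} \mid \Gamma \vdash C$; ($\mathsf{I}$R) $- \mid\ \vdash \mathsf{I}$; ($\otimes$L) from $A \mid B, \Gamma \vdash C$ infer $A \otimes B \mid \Gamma \vdash C$; ($\otimes$R) from $S \mid \Gamma \vdash A$ and $- \mid \Delta \vdash B$ infer $S \mid \Gamma, \Delta \vdash A \otimes B$. *)

(* Defs.v *)
From Stdlib Require Export List.
Export ListNotations.

Set Implicit Arguments.

Declare Scope skew_scope.
Open Scope skew_scope.

Inductive fma (Var : Type) : Type :=
| At (X : Var)
| I
| Tensor (A B : fma Var).

Arguments I {Var}.
Notation "A ⊗ B" := (Tensor A B) (at level 40, left associativity) : skew_scope.

Definition ctx (Var : Type) : Type := list (fma Var).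

(* [None] is the empty stoup "-". *)
Definition stoup (Var : Type) : Type := option (fma Var).

Reserved Notation "A ⇒ C" (at level 70, no associativity).

(* The judgements live in [Type], so that their inhabitants are the
   derivations themselves, which are not identified with one another. *)
Inductive cat (Var : Type) : fma Var -> fma Var -> Type :=
| id A : A ⇒ A
| comp A B C (f : A ⇒ B) (g : B ⇒ C) : A ⇒ C
| tensor A B C D (f : A ⇒ C) (g : B ⇒ D) : A ⊗ B ⇒ C ⊗ D
| lam A : I ⊗ A ⇒ A
| rho A : A ⇒ A ⊗ I
| alpha A B C : (A ⊗ B) ⊗ C ⇒ A ⊗ (B ⊗ C)
where "A ⇒ C" := (cat A C) : skew_scope.

Reserved Notation "S ∣ Γ ⊢ C" (at level 70, Γ at level 69, no associativity).

Inductive seqt (Var : Type) : stoup Var -> ctx Var -> fma Var -> Type :=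
| ax A : Some A ∣ [] ⊢ A
| pass A Γ C (f : Some A ∣ Γ ⊢ C) : None ∣ A :: Γ ⊢ C
| scut S Γ Δ A C (f : S ∣ Γ ⊢ A) (g : Some A ∣ Δ ⊢ C) : S ∣ Γ ++ Δ ⊢ C
| ccut S Γ Δ0 Δ1 A C (f : None ∣ Γ ⊢ A) (g : S ∣ Δ0 ++ A :: Δ1 ⊢ C) :
    S ∣ Δ0 ++ Γ ++ Δ1 ⊢ C
| IL Γ C (f : None ∣ Γ ⊢ C) : Some I ∣ Γ ⊢ C
| IR : None ∣ [] ⊢ I
| tensorL A B Γ C (f : Some A ∣ B :: Γ ⊢ C) : Some (A ⊗ B) ∣ Γ ⊢ C
| tensorR S Γ Δ A B (f : S ∣ Γ ⊢ A) (g : None ∣ Δ ⊢ B) : S ∣ Γ ++ Δ ⊢ A ⊗ B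
where "S ∣ Γ ⊢ C" := (seqt S Γ C) : skew_scope.

(* Main.v *)
Require Import Defs.

(** Induction on [f]: each categorical rule is derivable in the sequent calculus, composition being
    a stoup cut. The concatenated contexts are explicit lists, so they match by computation. *)

Lemma seqt_of_cat (Var : Type) (A C : fma Var) (f : A ⇒ C) : Some A ∣ [] ⊢ C.
Proof.
  induction f as [A | A B C f IHf g IHg | A B C D f IHf g IHg | A | A | A B C].
  - apply ax.
  - exact (scut IHf IHg).
  (* The second premise of [tensorR] has an empty stoup, so [pass] moves [B] from the stoup to the
     context, where [tensorL] absorbs it. *)
  - exact (tensorL (tensorR IHf (pass IHg))).
  - exact (tensorL (IL (pass (ax A)))).
  - exact (tensorR (ax A) (IR Var)).
  - exact (tensorL (tensorL
      (tensorR (ax A) (pass (tensorR (ax B) (pass (ax C))))))).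
Defined.

Theorem theorem3p2 (Var : Type) (A C : fma Var) (f : A ⇒ C) :
  inhabited (Some A ∣ [] ⊢ C).
Proof.
  exact (inhabits (seqt_of_cat _ _ _ f)).
Qed.
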